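(* Let $k,s\ge 1$ be integers, let $n=2ks$, let $a\in\mathbb{R}$ and $b,c\in\mathbb{R}\setminus\{0\}$, and let $A_k$ be the $n\times n$ Toeplitz matrix with entries $(A_k)_{i,i}=a$, $(A_k)_{i,i+k}=b$, $(A_k)_{i+k,i}=c$, and all other entries $0$. For $r=1,\dots,\frac{n}{k}$ put $$\lambda_r=a-2\sqrt{bc}\,\cos\left(\frac{kr\pi}{n+k}\right),\qquad \alpha_r=\frac{\lambda_r-a}{2\sqrt{bc}},\qquad \eta_r=\frac{k(4-4\alpha_r^2)}{2(n+k)},\qquad \mu=\frac{c}{b}.$$ Let $l$ be an integer; if $l<0$, assume moreover that $a\neq 2\sqrt{bc}\,\cos\left(\frac{kr\pi}{n+k}\right)$ for all $r=1,\dots,\frac nk$. Then the entries $q_{ij}(l)$ of $(A_k)^l$ ($1\le i,j\le n$) are given by $$q_{ij}(l)=\begin{cases}\displaystyle\sum_{r=1}^{n/k}\lambda_r^{\,l}\,\eta_r\,\mu^{\frac{i-j}{2k}}\,U_{\frac{i-\varphi_{ij}}{k}}(\alpha_r)\,U_{\frac{j-\varphi_{ij}}{k}}(\alpha_r), & \text{if } i=j,\ i=j+k \text{ or } i=j-k,\\[2mm] 0, & \text{otherwise,}\end{cases}$$ where $\varphi_{ij}=k$ if $i,j\equiv 0\pmod k$, and $\varphi_{ij}=m$ if $i,j\equiv m\pmod k$, with $m\in\{1,\dots,k-1\}$.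
   Context: $U_t$ denotes the Chebyshev polynomial of the second kind of degree $t$, i.e. $U_t(x)=\frac{\sin((t+1)\arccos x)}{\sin(\arccos x)}$. Square roots of negative real numbers are complex numbers.
   Formalization: The formula is stated for all i≡j (mod k), with 0 otherwise, since 0 for |i−j|≥2k fails (k=1, n=4, l=2: q_13=b²≠0); and μ^{1/2} is taken as √(bc)/b, which is the principal root only when b>0, since for b<0 the principal root gives wrong signs. *)

(* Defs.v *)
(* MathComp / MathComp-Analysis. *)
From HB Require Import structures.
From mathcomp Require Import all_boot all_order all_algebra.
From mathcomp Require Import complex ring.
From mathcomp Require Import all_classical all_reals all_analysis.
Set Implicit Arguments.
Unset Strict Implicit.
Unset Printing Implicit Defensive.
Import Order.TTheory GRing.Theory Num.Theory.
Local Open Scope ring_scope.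
Local Open Scope complex_scope.

Fixpoint chebyU (K : comNzRingType) (t : nat) : {poly K} :=
  match t with
  | 0 => 1
  | t1.+1 =>
      match t1 with
      | 0 => 2%:R *: 'X
      | t2.+1 => 2%:R *: 'X * chebyU K t1 - chebyU K t2
      end
  end.

Lemma chebyUSS (K : comNzRingType) (t : nat) :
  chebyU K t.+2 = 2%:R *: 'X * chebyU K t.+1 - chebyU K t.
Proof. by []. Qed.

(* chebyU R[i] t is the complex polynomial extending
   U_t(x) = sin((t+1) arccos x) / sin(arccos x). *)
Lemma chebyU_trig (R : realType) (t : nat) (x : R) : -1 < x < 1 ->
  (chebyU R[i] t).[x%:C] = (sin (t.+1%:R * acos x) / sin (acos x))%:C.
Proof.
move=> /andP[x1 x2].
have xB : -1 <= x <= 1 by rewrite !ltW.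
have s0 : sin (acos x) != 0.
  rewrite gt_eqF// sin_gt0_pi// acos_gt0 ?(ltW x1) ?x2//=.
  by rewrite acos_ltpi// x1 ltW.
have cx : cos (acos x) = x by rewrite acosK// in_itv.
suff: (chebyU R[i] t).[x%:C] = (sin (t.+1%:R * acos x) / sin (acos x))%:C /\
  (chebyU R[i] t.+1).[x%:C] = (sin (t.+2%:R * acos x) / sin (acos x))%:C by case.
elim: t => [|t [IH1 IH2]]; split => //.
- by rewrite /= hornerC mul1r divff.
- rewrite /= hornerZ hornerX.
  have -> : (2%:R : R[i]) = (2%:R : R)%:C by rewrite rmorph_nat.
  have -> : 2%:R * acos x = acos x + acos x by ring.
  by rewrite sinD cx -rmorphM /=; congr (_%:C); field.
- rewrite chebyUSS hornerD hornerN hornerM hornerZ hornerX IH1 IH2.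
  have -> : (2%:R : R[i]) = (2%:R : R)%:C by rewrite rmorph_nat.
  rewrite -!(rmorphM, rmorphB) /=; congr (_%:C).
  have -> : t.+3%:R * acos x = t.+2%:R * acos x + acos x.
    by rewrite -[t.+3]addn1 natrD mulrDl mul1r.
  have -> : t.+1%:R * acos x = t.+2%:R * acos x - acos x.
    by rewrite -[t.+2]addn1 natrD mulrDl mul1r addrK.
  by rewrite sinB sinD cx; field.
Qed.

(* 'I_n is 0-based, but only differences of indices matter here. *)
Definition toepk (R : nzRingType) (n k : nat) (a b c : R) : 'M[R]_n :=
  \matrix_(i, j) (if i == j :> nat then a
                  else if j == (i + k)%N :> nat then b
                  else if i == (j + k)%N :> nat then c else 0).

(* 'M_n has no inverse as a ring operation unless n is a successor, so the
   library's exprz does not apply. *)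
Definition mxpowz (R : comUnitRingType) (n : nat) (A : 'M[R]_n) (l : int) :
    'M[R]_n :=
  match l with
  | Posz m => A ^+ m
  | Negz m => invmx A ^+ m.+1
  end.

Section EntryFormula.
Variables (R : realType) (n k : nat) (a b c : R).

Definition sqrt_bc : R[i] := sqrtC (b * c)%:C.

Definition lambda (r : nat) : R[i] :=
  a%:C - 2%:R * sqrt_bc * (cos ((k * r)%N%:R * pi / (n + k)%N%:R))%:C.

Definition alpha (r : nat) : R[i] := (lambda r - a%:C) / (2%:R * sqrt_bc).

Definition eta (r : nat) : R[i] :=
  k%:R * (4%:R - 4%:R * alpha r ^+ 2) / (2%:R * (n + k)%N%:R).

Definition mu : R[i] := (c / b)%:C.

(* The square root of mu = c / b has to be chosen consistently with that of
   b * c, namely sqrt(mu) * b = sqrt(b c).  For b > 0 this is the principal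
   root (sqrt_mu_principal); for b < 0 it is the opposite one, and with the
   principal root the entries of A itself come out with the wrong sign
   (k = 1, n = 2, b, c < 0). *)
Definition sqrt_mu : R[i] := sqrt_bc / b%:C.

Lemma sqr_sqrt_mu : b != 0 -> sqrt_mu ^+ 2 = mu.
Proof.
move=> b0; rewrite expr_div_n sqrtCK -rmorphXn -fmorphV -rmorphM /=.
by congr (_%:C); field.
Qed.

(* mu ^ ((i - j) / (2 k)); used only when k divides i - j, so that the
   division below is exact. *)
Definition mu_pow (i j : nat) : R[i] :=
  sqrt_mu ^ ((i%:Z - j%:Z) %/ k%:Z)%Z.

(* Meaningful only for i = j mod k. *)
Definition phi (i j : nat) : nat :=
  if (k %| i)%N && (k %| j)%N then k else (i %% k)%N.

Definition entry_term (l : int) (i j r : nat) : R[i] :=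
  lambda r ^ l * eta r * mu_pow i j
  * (chebyU R[i] ((i - phi i j) %/ k)).[alpha r]
  * (chebyU R[i] ((j - phi i j) %/ k)).[alpha r].

End EntryFormula.

Lemma sqrt_mu_principal (R : realType) (b c : R) :
  0 < b -> sqrt_mu b c = sqrtC (mu b c).
Proof.
move=> b0; rewrite /sqrt_mu /sqrt_bc /mu.
have -> : b * c = b ^+ 2 * (c / b) by field; rewrite gt_eqF.
have bC : 0 <= b%:C by rewrite ler0c ltW.
rewrite rmorphM rmorphXn /= rootCMl ?exprn_ge0// sqrCK//.
by rewrite mulrC mulKf// eq_complex /= eqxx andbT gt_eqF.
Qed.

(* Main.v *)
Require Import Defs.
From HB Require Import structures.
From mathcomp Require Import all_boot all_order all_algebra.
From mathcomp Require Import complex ring zify.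
From mathcomp Require Import all_classical all_reals all_analysis.
Set Implicit Arguments.
Unset Strict Implicit.
Unset Printing Implicit Defensive.
Import Order.TTheory GRing.Theory Num.Theory.
Local Open Scope ring_scope.
Local Open Scope complex_scope.

(** Put [N = n / k] and [theta_r = r pi / (N + 1)], so that
    [alpha_r = - cos theta_r].  The nodes [alpha_r], [1 <= r <= N], are the
    zeros of [U_N], so the vectors [(U_0(alpha_r), ..., U_(N-1)(alpha_r))] are
    eigenvectors, with eigenvalues [2 alpha_r], of the symmetric tridiagonal
    matrix with ones beside the diagonal.  With the weights
    [eta_r = 2 sin^2 theta_r / (N + 1)], the relation
    [U_t(- cos x) sin x = (-1)^t sin ((t + 1) x)] turns the discrete
    orthogonality of the sines into
    [\sum_r eta_r U_p(alpha_r) U_q(alpha_r) = (p == q)]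
    ([chebyU_orthonormal]).  The matrix [A_k] is made of [k] interleaved copies
    of a tridiagonal Toeplitz matrix, one for each residue of the indices
    modulo [k]; a diagonal change of basis with powers of [sqrt_mu] makes each
    copy symmetric.

    Let [Q_l] be the matrix given by the formula for the exponent [l].  No
    diagonalization is needed: the three-term recurrence of the [U_t], together
    with [U_N(alpha_r) = 0] at the lower end, gives [A Q_l = Q_(l+1)]
    ([mul_toepk_specmx]), and orthogonality gives [Q_0 = 1] ([specmx0]).
    Induction yields [A^l = Q_l] for [l >= 0].  When no [lambda_r] vanishes,
    [A Q_(-1) = Q_0 = 1] shows that [A] is invertible, and a second induction
    covers [l < 0] ([mxpowz_toepk]).  The parity of [N] plays no role. *)

(** * Sine sums and Chebyshev polynomials at the nodes *)

Section Trigonometry.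
Variable R : realType.

Lemma sin_natpiB (m : nat) (y : R) :
  sin (m%:R * pi - y) = - (-1) ^+ m * sin y.
Proof.
elim: m => [|m IHm]; first by rewrite mul0r sub0r sinN mulN1r.
have -> : m.+1%:R * pi - y = m%:R * pi - y + pi.
  by rewrite -[m.+1]addn1 natrD; ring.
by rewrite sinDpi IHm exprS; ring.
Qed.

(** The angle [r pi / (N + 1)]. *)
Definition theta (N r : nat) : R := r%:R * pi / N.+1%:R.

Lemma sin_theta_neq0 N r : (1 <= r <= N)%N -> sin (theta N r) != 0.
Proof.
move=> /andP[r1 rN]; rewrite gt_eqF// sin_gt0_pi// /theta.
have N0 : 0 < N.+1%:R :> R by rewrite ltr0n.
rewrite divr_gt0 ?mulr_gt0 ?pi_gt0 ?ltr0n//=.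
by rewrite ltr_pdivrMr// mulrC ltr_pM2l ?pi_gt0// ltr_nat ltnS.
Qed.

(** The sum telescopes after multiplication by [2 sin h], where
    [h = m pi / (2 (N + 1))] is half the step of the arithmetic progression of
    angles.  The bound on [m] ensures that [sin h] is nonzero; [h] is also an
    angle [theta], for [2 (N + 1) - 1] in place of [N]. *)
Lemma sum_cos_theta N m : (0 < m < 2 * N.+1)%N ->
  \sum_(0 <= r < N.+1) cos (m%:R * theta N r) = (odd m)%:R.
Proof.
move=> /andP[m0 mN].
have N0 : N.+1%:R != 0 :> R by rewrite pnatr_eq0.
have s0 : sin (theta (2 * N.+1).-1 m) != 0.
  by apply: sin_theta_neq0; rewrite m0 /=; lia.
have hE : theta (2 * N.+1).-1 m = m%:R * pi / (2 * N.+1%:R).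
  by rewrite /theta prednK// natrM.
set h := theta (2 * N.+1).-1 m in s0 hE.
apply: (mulfI (x := 2 * sin h)); first by rewrite mulf_neq0// pnatr_eq0.
pose f (r : nat) : R := sin (m%:R * theta N r - h).
rewrite big_distrr /=.
transitivity (\sum_(0 <= r < N.+1) (f r.+1 - f r)).
  apply: eq_bigr => r _; rewrite /f.
  have -> : m%:R * theta N r.+1 - h = m%:R * theta N r + h.
    by rewrite hE /theta -[r.+1]addn1 natrD; field.
  by rewrite sinD sinB; ring.
rewrite telescope_sumr// /f.
have -> : m%:R * theta N N.+1 - h = m%:R * pi - h.
  by rewrite /theta; field.
rewrite sin_natpiB -[RHS]mulrC /theta !mul0r mulr0 sub0r sinN -signr_odd.
by case: (odd m) => /=; ring.
Qed.

Lemma sum_sin_theta N p q : (p < N)%N -> (q < N)%N ->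
  \sum_(1 <= r < N.+1) sin (p.+1%:R * theta N r) * sin (q.+1%:R * theta N r)
  = if p == q then N.+1%:R / 2 else 0.
Proof.
wlog qp : p q / (q <= p)%N => [H pN qN|pN qN].
  have [qp|/ltnW pq] := leqP q p; first exact: H.
  rewrite eq_sym -H//; apply: eq_bigr => r _; exact: mulrC.
(* The term of index 0 vanishes, and can be added to the sum. *)
have -> : \sum_(1 <= r < N.+1) sin (p.+1%:R * theta N r) *
    sin (q.+1%:R * theta N r) =
    \sum_(0 <= r < N.+1) sin (p.+1%:R * theta N r) * sin (q.+1%:R * theta N r).
  by rewrite [RHS]big_ltn// /theta !mul0r mulr0 sin0 mul0r add0r.
have -> : \sum_(0 <= r < N.+1) sin (p.+1%:R * theta N r) *
    sin (q.+1%:R * theta N r) =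
    (\sum_(0 <= r < N.+1) cos ((p - q)%N%:R * theta N r) -
     \sum_(0 <= r < N.+1) cos ((p + q).+2%:R * theta N r)) / 2.
  rewrite -sumrB mulr_suml; apply: eq_bigr => r _.
  have -> : (p - q)%N%:R * theta N r = p.+1%:R * theta N r - q.+1%:R * theta N r.
    by rewrite natrB// -[p.+1]addn1 -[q.+1]addn1 !natrD; ring.
  have -> : (p + q).+2%:R * theta N r = p.+1%:R * theta N r + q.+1%:R * theta N r.
    by rewrite -mulrDl -natrD addSn addnS.
  by rewrite cosB cosD; field.
rewrite [X in _ - X]sum_cos_theta; last by apply/andP; split; lia.
have [->|pq] := eqVneq p q.
  rewrite subnn addnn /= negbK odd_double subr0.
  under eq_bigr do rewrite mul0r cos0.
  by rewrite sumr_const_nat subn0.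
rewrite sum_cos_theta; last by apply/andP; split; lia.
by rewrite /= negbK oddD oddB// subrr mul0r.
Qed.

(** Valid also where [sin x = 0]. *)
Lemma chebyU_opp_cos (t : nat) (x : R) :
  (chebyU R[i] t).[(- cos x)%:C] * (sin x)%:C
  = ((-1) ^+ t * sin (t.+1%:R * x))%:C.
Proof.
suff: (chebyU R[i] t).[(- cos x)%:C] * (sin x)%:C
    = ((-1) ^+ t * sin (t.+1%:R * x))%:C /\
  (chebyU R[i] t.+1).[(- cos x)%:C] * (sin x)%:C
    = ((-1) ^+ t.+1 * sin (t.+2%:R * x))%:C by case.
have two : (2%:R : R[i]) = (2%:R : R)%:C by rewrite rmorph_nat.
elim: t => [|t [IH1 IH2]]; split => //.
- by rewrite /= hornerC !mul1r.
- rewrite /= hornerZ hornerX two -!rmorphM /=; congr (_%:C).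
  have -> : 2%:R * x = x + x by ring.
  by rewrite sinD expr1; ring.
- rewrite chebyUSS hornerD hornerN hornerM hornerZ hornerX.
  rewrite mulrBl -[2%:R * _ * _ * _]mulrA IH1 IH2 two -!(rmorphM, rmorphB) /=; congr (_%:C).
  have -> : t.+3%:R * x = t.+2%:R * x + x.
    by rewrite -[t.+3]addn1 natrD mulrDl mul1r.
  have -> : t.+1%:R * x = t.+2%:R * x - x.
    by rewrite -[t.+2]addn1 natrD mulrDl mul1r addrK.
  by rewrite sinB sinD !exprS; ring.
Qed.

Lemma chebyU_root N r : (1 <= r <= N)%N ->
  (chebyU R[i] N).[(- cos (theta N r))%:C] = 0.
Proof.
move=> rN; have s0 := sin_theta_neq0 rN.
apply: (mulIf (x := (sin (theta N r))%:C)).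
  by rewrite eq_complex /= eqxx andbT.
rewrite chebyU_opp_cos mul0r.
have -> : N.+1%:R * theta N r = r%:R * pi - 0.
  by rewrite /theta subr0; field; rewrite addrC natr1 pnatr_eq0.
by rewrite sin_natpiB sin0 !mulr0.
Qed.

End Trigonometry.

(** * Spectral formula for the Toeplitz matrix *)

Section Spectrum.
Variables (R : realType) (N k : nat) (a b c : R).
Hypotheses (k_gt0 : (0 < k)%N) (b_neq0 : b != 0) (c_neq0 : c != 0).

Local Notation n := (N * k)%N.
Local Notation lam := (lambda n k a b c).
Local Notation al := (alpha n k a b c).
Local Notation et := (Defs.eta n k a b c).
Local Notation sbc := (sqrt_bc b c).
Local Notation sm := (sqrt_mu b c).

Let bC_neq0 : b%:C != 0 :> R[i].
Proof. by rewrite eq_complex /= eqxx andbT. Qed.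

Lemma sqrt_bc_neq0 : sbc != 0.
Proof.
by rewrite /sqrt_bc sqrtC_eq0 eq_complex /= eqxx andbT mulf_neq0.
Qed.

Lemma sqrt_mu_neq0 : sm != 0.
Proof. by rewrite /sqrt_mu mulf_neq0 ?invr_eq0 ?sqrt_bc_neq0. Qed.

Lemma mulb_sqrt_mu : b%:C * sm = sbc.
Proof. by rewrite /sqrt_mu mulrC divfK. Qed.

Lemma mulc_sqrt_muV : c%:C / sm = sbc.
Proof.
rewrite /sqrt_mu invf_div mulrA -rmorphM mulrC /= [c * b]mulrC.
rewrite -[(b * c)%:C]sqrtCK -/sbc expr2 mulrA.
by rewrite mulVf ?mul1r ?sqrt_bc_neq0.
Qed.

Lemma angle_theta r : (k * r)%N%:R * pi / (n + k)%N%:R = theta R N r.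
Proof.
rewrite /theta -mulSnr !natrM; field.
by rewrite [1 + _]addrC natr1 !pnatr_eq0 -!lt0n k_gt0.
Qed.

Lemma alphaE r : al r = (- cos (theta R N r))%:C.
Proof.
rewrite /alpha /lambda angle_theta addrAC subrr add0r -mulrN -rmorphN mulrC.
by rewrite mulKf// mulf_neq0 ?pnatr_eq0 ?sqrt_bc_neq0.
Qed.

Lemma lambdaE r : lam r = a%:C + 2%:R * sbc * al r.
Proof. by rewrite alphaE /lambda angle_theta rmorphN mulrN. Qed.

Lemma etaE r : et r = (2 / N.+1%:R * sin (theta R N r) ^+ 2)%:C.
Proof.
rewrite /Defs.eta alphaE sin2cos2 -mulSnr.
rewrite -[k%:R](rmorph_nat (real_complex R)) -[4%:R](rmorph_nat (real_complex R)).
rewrite -[2%:R](rmorph_nat (real_complex R)).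
rewrite -[(N.+1 * k)%:R](rmorph_nat (real_complex R)).
rewrite -!(rmorphM, rmorphB, rmorphXn, fmorphV) /=; congr (_%:C).
rewrite natrM; field.
by rewrite addrC natr1 !pnatr_eq0 -!lt0n k_gt0.
Qed.

(** The signs [(-1)^p] and [(-1)^q] coming from [chebyU_opp_cos] cancel when
    [p = q]. *)
Lemma chebyU_orthonormal p q : (p < N)%N -> (q < N)%N ->
  \sum_(1 <= r < N.+1) et r * (chebyU R[i] p).[al r] * (chebyU R[i] q).[al r]
  = (p == q)%:R.
Proof.
move=> pN qN.
transitivity ((2 / N.+1%:R * (-1) ^+ (p + q) * (\sum_(1 <= r < N.+1)
    sin (p.+1%:R * theta R N r) * sin (q.+1%:R * theta R N r)))%:C).
  rewrite rmorphM rmorph_sum big_distrr /=; apply: eq_bigr => r _.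
  transitivity ((2 / N.+1%:R)%:C *
    ((chebyU R[i] p).[al r] * (sin (theta R N r))%:C) *
    ((chebyU R[i] q).[al r] * (sin (theta R N r))%:C)).
    by rewrite etaE rmorphM rmorphXn /=; ring.
  by rewrite alphaE !chebyU_opp_cos -!rmorphM /= exprD; congr (_%:C); ring.
rewrite sum_sin_theta//; have [->|_] := eqVneq p q; last by rewrite mulr0.
rewrite addnn -signr_odd odd_double mulr1 -[1%:R](rmorph1 (real_complex R)).
by congr (_%:C); field; rewrite addrC natr1 pnatr_eq0.
Qed.

(** The entry of index [(i, j)], counted from 0, in the formula for the
    exponent [l].  With such indices, the degrees of the two polynomials are
    the quotients of [i] and [j] by [k]. *)
Definition spec (l : int) (i j : nat) : R[i] :=
  if (i == j %[mod k])%N then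
    \sum_(1 <= r < N.+1) lam r ^ l * et r * sm ^ ((i %/ k)%N%:Z - (j %/ k)%N%:Z)
      * (chebyU R[i] (i %/ k)).[al r] * (chebyU R[i] (j %/ k)).[al r]
  else 0.

Lemma spec0 i j : (i < n)%N -> (j < n)%N -> spec 0 i j = (i == j)%:R.
Proof.
move=> iN jN; rewrite /spec.
have [ij|ij] := eqVneq (i %% k)%N (j %% k)%N; last first.
  by case: eqP => // eij; rewrite eij eqxx in ij.
transitivity (sm ^ ((i %/ k)%N%:Z - (j %/ k)%N%:Z) * (\sum_(1 <= r < N.+1)
    et r * (chebyU R[i] (i %/ k)).[al r] * (chebyU R[i] (j %/ k)).[al r])).
  by rewrite big_distrr /=; apply: eq_bigr => r _; rewrite expr0z; ring.
rewrite chebyU_orthonormal ?ltn_divLR//.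
have -> : (i == j) = (i %/ k == j %/ k)%N.
  apply/eqP/eqP => [->//|e].
  by rewrite (divn_eq i k) (divn_eq j k) e ij.
by case: eqP => [->|_]; rewrite ?subrr ?expr0z ?mulr0 ?mulr1.
Qed.

(** Multiplication by the matrix, read on entries.  The hypothesis on the
    powers of the eigenvalues can fail only at [lambda_r = 0] with [l < 0]. *)
Lemma specS (l : int) i j : (i < n)%N ->
    (forall r, (1 <= r <= N)%N -> lam r ^ (l + 1) = lam r ^ l * lam r) ->
  a%:C * spec l i j + (if (i + k < n)%N then b%:C * spec l (i + k) j else 0)
    + (if (k <= i)%N then c%:C * spec l (i - k) j else 0)
  = spec (l + 1) i j.
Proof.
move=> iN hlam; rewrite /spec modnDr.
(* Truncated subtraction is harmless: the subdiagonal term is present only when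
   [k <= i], and then [i - k] and [i] have the same residue. *)
have -> : (if (k <= i)%N then c%:C * (if (i - k == j %[mod k])%N then
    \sum_(1 <= r < N.+1) lam r ^ l * et r
      * sm ^ (((i - k) %/ k)%N%:Z - (j %/ k)%N%:Z)
      * (chebyU R[i] ((i - k) %/ k)).[al r] * (chebyU R[i] (j %/ k)).[al r]
   else 0) else 0) =
  (if (i == j %[mod k])%N then (if (k <= i)%N then c%:C *
    \sum_(1 <= r < N.+1) lam r ^ l * et r
      * sm ^ (((i %/ k).-1)%N%:Z - (j %/ k)%N%:Z)
      * (chebyU R[i] (i %/ k).-1).[al r] * (chebyU R[i] (j %/ k)).[al r]
      else 0) else 0).
  case: (leqP k i) => ki; last by case: ifP.
  have -> : ((i - k) %% k = i %% k)%N by rewrite -{2}(subnK ki) modnDr.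
  by case: ifP; rewrite ?mulr0 // divnBr ?dvdnn// divnn k_gt0 subn1.
case: ifP => _; last by rewrite !mulr0 !if_same !addr0.
rewrite divnDr ?dvdnn// divnn k_gt0 addn1 -(divn_gt0 i k_gt0).
have -> : (i + k < n)%N = ((i %/ k).+1 < N)%N.
  by rewrite -ltn_divLR// divnDr ?dvdnn// divnn k_gt0 addn1.
have : (i %/ k < N)%N by rewrite ltn_divLR.
move: (i %/ k)%N (j %/ k)%N => p q pN.
set e : int := p%:Z - q%:Z.
have eS : p.+1%:Z - q%:Z = e + 1 by rewrite /e; lia.
have smS : sm ^ (e + 1) = sm ^ e * sm by rewrite expfzDr ?sqrt_mu_neq0// expr1z.
have -> : (if (p.+1 < N)%N then b%:C * \sum_(1 <= r < N.+1)
      lam r ^ l * et r * sm ^ (p.+1%:Z - q%:Z)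
      * (chebyU R[i] p.+1).[al r] * (chebyU R[i] q).[al r] else 0) =
    \sum_(1 <= r < N.+1) sbc * (lam r ^ l * et r * sm ^ e
      * (chebyU R[i] p.+1).[al r] * (chebyU R[i] q).[al r]).
  case: ltnP => Np.
    rewrite big_distrr /=; apply: eq_bigr => r _.
    by rewrite -mulb_sqrt_mu eS smS; ring.
  (* On the last row of blocks, the missing term carries [U_N(alpha_r) = 0]. *)
  rewrite big_nat_cond big1// => r /andP[rN _].
  have <- : N = p.+1 by apply/eqP; rewrite eqn_leq Np pN.
  by rewrite alphaE chebyU_root ?mulr0 ?mul0r ?mulr0.
(* On the first row of blocks, [U_(-1)] is taken to be 0. *)
have -> : (if (0 < p)%N then c%:C * \sum_(1 <= r < N.+1)
      lam r ^ l * et r * sm ^ (p.-1%:Z - q%:Z)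
      * (chebyU R[i] p.-1).[al r] * (chebyU R[i] q).[al r] else 0) =
    \sum_(1 <= r < N.+1) sbc * (lam r ^ l * et r * sm ^ e
      * (if p is p1.+1 then (chebyU R[i] p1).[al r] else 0)
      * (chebyU R[i] q).[al r]).
  rewrite /e; case: (p) => [|p1] /=.
    by rewrite big1// => r _; rewrite mulr0 mul0r mulr0.
  rewrite big_distrr /=; apply: eq_bigr => r _.
  have -> : p1.+1%:Z - q%:Z = p1%:Z - q%:Z + 1 by lia.
  rewrite [sm ^ (_ + 1)]expfzDr ?sqrt_mu_neq0// expr1z -mulc_sqrt_muV; field.
  exact: sqrt_mu_neq0.
rewrite big_distrr -!big_split /=; apply: eq_big_nat => r rN.
rewrite hlam//; move: (lam r ^ l) => x; rewrite lambdaE.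
have -> : (chebyU R[i] p.+1).[al r] = 2%:R * al r * (chebyU R[i] p).[al r]
    - (if p is p1.+1 then (chebyU R[i] p1).[al r] else 0).
  case: (p) => [|p1]; first by rewrite /= hornerZ hornerX hornerC subr0 mulr1.
  by rewrite chebyUSS hornerD hornerN hornerM hornerZ hornerX.
move: (sm ^ e) (et r) (if p is _.+1 then _ else _) => y z u.
by ring.
Qed.

(** The matrix given by the formula for the exponent [l]. *)
Definition specmx (l : int) : 'M[R[i]]_n := \matrix_(i, j) spec l i j.

Local Notation A := (map_mx (real_complex R) (toepk n k a b c)).

Lemma specmx0 : specmx 0 = 1%:M.
Proof. by apply/matrixP => i j; rewrite !mxE spec0. Qed.

Lemma mul_toepk_specmx (l : int) :
    (forall r, (1 <= r <= N)%N -> lam r ^ (l + 1) = lam r ^ l * lam r) ->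
  A *m specmx l = specmx (l + 1).
Proof.
move=> hlam; apply/matrixP => i j; rewrite !mxE -specS//.
under eq_bigr => m _ do rewrite !mxE.
transitivity (\sum_(m < n) ((if (m == i :> nat) then a%:C * spec l m j else 0)
   + (if (m == (i + k)%N :> nat) then b%:C * spec l m j else 0)
   + (if (k <= i)%N then (if (m == (i - k)%N :> nat) then c%:C * spec l m j
      else 0) else 0))).
  apply: eq_bigr => m _.
  move: (m : nat) (nat_of_ord i) => {}m i'.
  have [->|mi] := eqVneq m i'.
    case: eqP => [|_]; first lia.
    by case: ifP => // ki; first case: eqP => [|_]; rewrite ?addr0//; lia.
  rewrite add0r; have [->|mk] := eqVneq m (i' + k)%N.
    by case: ifP => // ki; first case: eqP => [|_]; rewrite ?addr0//; lia.
  rewrite add0r; have [ki|ki] := leqP k i'.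
     have -> : (i' == m + k)%N = (m == i' - k)%N by apply/eqP/eqP; lia.
    by case: eqP => _; rewrite // mul0r.
  by case: eqP => [|_]; [lia|rewrite mul0r].
rewrite !big_split /= -!big_mkcond /=.
rewrite (big_ord1_eq _ (fun m => a%:C * spec l m j)) ltn_ord.
rewrite (big_ord1_eq _ (fun m => b%:C * spec l m j)).
congr (_ + _); case: ifP => ki; last by rewrite big1.
rewrite -big_mkcond (big_ord1_eq _ (fun m => c%:C * spec l m j)).
by rewrite ifT// (leq_ltn_trans (leq_subr _ _)).
Qed.

Lemma mxpowz_toepk (l : int) :
    (l < 0 -> forall r, (1 <= r <= N)%N -> lam r != 0) ->
  map_mx (real_complex R) (mxpowz (toepk n k a b c) l) = specmx l.
Proof.
case: l => m hl /=.
  elim: m {hl} => [|m IHm]; first by rewrite expr0 map_mx1 -specmx0.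
  rewrite exprS map_mxM IHm mul_toepk_specmx -?PoszD ?addn1// => r _.
  by rewrite -!exprnP exprSr.
have lam0 := hl isT.
have AS l : A *m specmx l = specmx (l + 1).
  by apply: mul_toepk_specmx => r rN; rewrite expfzDr ?lam0// expr1z.
have AV : A *m specmx (- 1) = 1%:M by rewrite AS addNr specmx0.
have [Au _] := mulmx1_unit AV.
have VS l : invmx A *m specmx (l + 1) = specmx l.
  by rewrite -AS mulmxA mulVmx// mul1mx.
elim: m {hl} => [|m IHm].
  by rewrite expr1 map_invmx -[LHS]mulmx1 -specmx0 -(VS (Negz 0)).
rewrite exprS map_mxM IHm map_invmx -(VS (Negz m.+1)).
by congr (_ *m specmx _); lia.
Qed.

End Spectrum.

(** * The degrees and exponents of the formula *)

(** Indices counted from 1 on the left, from 0 on the right. *)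
Lemma divn_subphi k i j : (0 < k)%N -> i.+1 = j.+1 %[mod k] ->
  ((i.+1 - phi k i.+1 j.+1) %/ k = i %/ k)%N.
Proof.
move=> k0 ij; rewrite /phi [(k %| j.+1)%N]/dvdn -ij -/(dvdn k i.+1) andbb.
have := divnS i k0; case: ifP => ki /= E.
  by rewrite divnBr ?dvdnn// divnn k0 E add1n subn1.
by rewrite {1}(divn_eq i.+1 k) addnK mulnK.
Qed.

Lemma divz_eqmod k i j : (0 < k)%N -> i = j %[mod k] ->
  ((i%:Z - j%:Z) %/ k%:Z)%Z = (i %/ k)%N%:Z - (j %/ k)%N%:Z.
Proof.
move=> k0 ij; rewrite {1}(divn_eq i k) {1}(divn_eq j k) ij.
have -> : ((i %/ k * k + j %% k)%N%:Z - (j %/ k * k + j %% k)%N%:Z =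
  ((i %/ k)%N%:Z - (j %/ k)%N%:Z) * k%:Z)%R by rewrite !PoszD !PoszM; ring.
by rewrite mulzK// eqz_nat -lt0n.
Qed.

(* The nonzero entries of the powers of A_k are not confined to i = j and
   i = j +- k: already A_1 ^ 2 has the entry b ^ 2 <> 0 at (1, 3) when n = 4.
   The first case of the formula is therefore stated for i = j mod k, which is
   also the domain of phi.  Indices are shifted to 1, ..., n. *)
Theorem mainTheorem2 (R : realType) (k s n : nat) (a b c : R) (l : int)
    (hk : (1 <= k)%N) (hs : (1 <= s)%N) (hn : n = (2 * k * s)%N)
    (hb : b != 0) (hc : c != 0)
    (hl : l < 0 -> forall r : nat, (1 <= r <= n %/ k)%N ->
       a%:C != 2%:R * sqrt_bc b c * (cos ((k * r)%N%:R * pi / (n + k)%N%:R))%:C)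
    (i j : 'I_n) :
  (mxpowz (toepk n k a b c) l i j)%:C =
  if i.+1 == j.+1 %[mod k]
  then \sum_(1 <= r < (n %/ k).+1) entry_term n k a b c l i.+1 j.+1 r
  else 0.
Proof.
move: hl i j; have -> : n = (2 * s * k)%N by rewrite hn mulnAC.
rewrite mulnK// => hl i j.
have := @mxpowz_toepk R (2 * s) k a b c hk hb hc l.
move=> /(_ _)/matrixP-/(_ _ i j); rewrite !mxE => -> => [|l0 r rN]; last first.
  by rewrite /lambda subr_eq0 hl.
rewrite /spec -[i.+1]addn1 -[j.+1]addn1 eqn_modDr !addn1.
case: eqP => // ij; apply: eq_bigr => r _; rewrite /entry_term.
have ijS : i.+1 = j.+1 %[mod k].
  by apply/eqP; rewrite -[i.+1]addn1 -[j.+1]addn1 eqn_modDr ij.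
have phiC : phi k i.+1 j.+1 = phi k j.+1 i.+1 by rewrite /phi andbC ijS.
rewrite divn_subphi// phiC divn_subphi// /mu_pow.
have -> : (i.+1%:Z - j.+1%:Z = i%:Z - j%:Z :> int)%R by lia.
by rewrite divz_eqmod.
Qed.
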